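(* The invariant $\mathrm{secat}^{\mathrm{op}}$, defined for maps in $\mathcal{T}$, satisfies the following three axioms. S0. For any map $\iota\colon A\to Y$ in $\mathcal{T}$, $\mathrm{secat}^{\mathrm{op}}(\iota)=0$ if and only if $\iota$ has a homotopy section, i.e. there is a map $s\colon Y\to A$ with $\iota\circ s\simeq \mathrm{id}_Y$. S1. For any maps $\kappa\colon B\to X$, $\iota\colon A\to X$ and $\zeta\colon B\to A$ in $\mathcal{T}$ with $\iota\circ\zeta\simeq\kappa$, one has $\mathrm{secat}^{\mathrm{op}}(\iota)\leq \mathrm{secat}^{\mathrm{op}}(\kappa)$. S2. For any homotopy pullback square in $\mathcal{T}$ formed by $p\colon P\to A$, $q\colon P\to X$, $\iota\colon A\to Y$, $f\colon X\to Y$ (with $\iota\circ p\simeq f\circ q$), one has $\mathrm{secat}^{\mathrm{op}}(q)\leq\mathrm{secat}^{\mathrm{op}}(\iota)$.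
   Context: $\mathcal{T}$ denotes either $\mathbf{Top}$ (topological spaces, continuous maps, free homotopies) or $\mathbf{Top}^w$ (well-pointed spaces, i.e. the inclusion of the basepoint is a closed cofibration; basepoint-preserving continuous maps; pointed homotopies). Spaces are non-empty, except that the homotopy pullback $P$ of two maps in $\mathbf{Top}$ may be empty. $\simeq$ means homotopic. Homotopy pullbacks are the usual ones (Mather): homotopy commutative squares equivalent, up to homotopy equivalence, to the pullback obtained after replacing one of the two maps by a fibration. For $\iota\colon A\to Y$ in $\mathcal{T}$, $\mathrm{secat}^{\mathrm{op}}(\iota)$ is the least integer $n$ for which there exist an open cover $(U_i)_{0\leq i\leq n}$ of $Y$ and maps $l_i\colon U_i\to A$ such that $\iota\circ l_i$ is homotopic to the inclusion $U_i\hookrightarrow Y$ for all $i$; it is $\infty$ if no such $n$ exists. In $\mathbf{Top}^w$ each $U_i$ must contain the basepoint of $Y$ and maps and homotopies are pointed. *)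

(* Defs.v *)
From HB Require Import structures.
From mathcomp Require Import all_boot all_order all_algebra.
From mathcomp Require Import all_classical all_reals.
From mathcomp Require Import ereal topology normedtype.
Import numFieldNormedType.Exports.

Set Implicit Arguments.
Unset Strict Implicit.
Unset Printing Implicit Defensive.

Import Order.TTheory GRing.Theory Num.Theory.
Local Open Scope classical_set_scope.
Local Open Scope ring_scope.

Inductive category := Top | TopW.

(* Free and pointed spaces are treated uniformly: [base X] is empty for a
   space of Top and is the singleton of the basepoint for a space of TopW.
   Maps and homotopies preserve [base], which is no condition in the first case
   and makes them pointed in the second. *)
Record tspace := Space { carrier :> topologicalType ; base : set carrier }.
Arguments base : clear implicits.

(* Homotopies are functions on [X * R] of which only the values on
   [X * `[0, 1]] matter. *)
Definition closed_cofibration (R : realType) (X : topologicalType)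
    (A : set X) : Prop :=
  closed A /\
  forall (Z : topologicalType) (g : X -> Z) (h : X * R -> Z),
    continuous g -> {within A `*` `[0, 1], continuous h} ->
    (forall a, A a -> h (a, 0) = g a) ->
    exists H : X * R -> Z,
      [/\ {within [set: X] `*` `[0, 1], continuous H},
          forall x, H (x, 0) = g x
        & forall a t, A a -> t \in `[0, 1] -> H (a, t) = h (a, t)].

Definition based (T : category) (X : tspace) : Prop :=
  match T with
  | Top => base X = set0
  | TopW => exists x0 : X, base X = [set x0]
  end.

(* Objects of T, the empty space being allowed for Top. *)
Definition in_cat (R : realType) (T : category) (X : tspace) : Prop :=
  based T X /\
  match T with
  | Top => True
  | TopW => closed_cofibration R (base X)
  end.

Definition object (R : realType) (T : category) (X : tspace) : Prop :=
  in_cat R T X /\ [set: X] !=set0.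

Definition is_map (X Y : tspace) (f : X -> Y) : Prop :=
  continuous f /\ f @` base X `<=` base Y.

Definition is_homotopy (R : realType) (X Y : tspace) (H : X * R -> Y) : Prop :=
  {within [set: X] `*` `[0, 1], continuous H} /\
  forall x t, base X x -> t \in `[0, 1] -> base Y (H (x, t)).

Definition homotopic (R : realType) (X Y : tspace) (f g : X -> Y) : Prop :=
  exists H : X * R -> Y,
    [/\ is_homotopy H, forall x, H (x, 0) = f x & forall x, H (x, 1) = g x].

Definition homotopy_equivalence (R : realType) (X Y : tspace) (f : X -> Y)
    : Prop :=
  is_map f /\
  exists g : Y -> X,
    [/\ is_map g, homotopic R (g \o f) idfun & homotopic R (f \o g) idfun].

(* Homotopy lifting property for all spaces in the case of Top, and its pointed
   version for all pointed spaces in the case of TopW. Between well-pointed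
   spaces the latter is the same as being a Hurewicz fibration: test it on
   [Z] with a disjoint basepoint for one direction, and on the mapping path
   space of [pi], which is well-pointed, for the other. *)
Definition fibration (R : realType) (T : category) (E Y : tspace)
    (pi : E -> Y) : Prop :=
  is_map pi /\
  forall (Z : tspace) (g : Z -> E) (h : Z * R -> Y),
    based T Z -> is_map g -> is_homotopy h ->
    (forall z, h (z, 0) = pi (g z)) ->
    exists H : Z * R -> E,
      [/\ is_homotopy H, forall z, H (z, 0) = g z
        & forall z t, t \in `[0, 1] -> pi (H (z, t)) = h (z, t)].

Definition fibration_replacement (R : realType) (T : category)
    (A E Y : tspace) (iota : A -> Y) (e : A -> E) (pi : E -> Y) : Prop :=
  [/\ object R T E, homotopy_equivalence R e, fibration R T pi
    & pi \o e =1 iota].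

Definition pullback (E X Y : tspace) (pi : E -> Y) (f : X -> Y) : tspace :=
  @Space (set_type [set z : E * X | pi z.1 = f z.2])
         [set u | base E (set_val u).1 /\ base X (set_val u).2].

Definition pullback_fst (E X Y : tspace) (pi : E -> Y) (f : X -> Y)
  : pullback pi f -> E := fun u => (set_val u).1.

Definition pullback_snd (E X Y : tspace) (pi : E -> Y) (f : X -> Y)
  : pullback pi f -> X := fun u => (set_val u).2.

(* No coherence with a prescribed homotopy [iota \o p ~ f \o q] is demanded:
   the comparison map and its two homotopies always determine one. *)
Definition homotopy_pullback (R : realType) (T : category)
    (P A X Y : tspace) (p : P -> A) (q : P -> X) (iota : A -> Y) (f : X -> Y)
    : Prop :=
  homotopic R (iota \o p) (f \o q) /\
  ((exists (E : tspace) (e : A -> E) (pi : E -> Y) (h : P -> pullback pi f),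
      [/\ fibration_replacement R T iota e pi,
          homotopy_equivalence R h,
          homotopic R (@pullback_fst _ _ _ pi f \o h) (e \o p)
        & homotopic R (@pullback_snd _ _ _ pi f \o h) q])
   \/
   (exists (E : tspace) (e : X -> E) (pi : E -> Y) (h : P -> pullback iota pi),
      [/\ fibration_replacement R T f e pi,
          homotopy_equivalence R h,
          homotopic R (@pullback_fst _ _ _ iota pi \o h) p
        & homotopic R (@pullback_snd _ _ _ iota pi \o h) (e \o q)])).

Definition subspace_of (Y : tspace) (U : set Y) : tspace :=
  @Space (set_type U) (set_val @^-1` base Y).

Definition has_secat_cover (R : realType) (A Y : tspace) (iota : A -> Y)
    (n : nat) : Prop :=
  exists U : 'I_n.+1 -> set Y,
    [/\ forall i, open (U i),
        \bigcup_i U i = [set: Y],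
        forall i, base Y `<=` U i
      & forall i, exists l : subspace_of (U i) -> A,
          is_map l /\
          homotopic R (iota \o l) (set_val : subspace_of (U i) -> Y)].

Definition secat_op (R : realType) (A Y : tspace) (iota : A -> Y) : \bar R :=
  if pselect (exists n, `[< has_secat_cover R iota n >]) is left ex_n
  then ((ex_minn ex_n)%:R)%:E else +oo%E.

(* Main.v *)
(* The homotopy pullback has a weak universal property: a map [j : Z -> X]
   lifts up to homotopy through [q : P -> X] as soon as [f \o j] lifts up to
   homotopy through [iota : A -> Y]. One rectifies the homotopy by lifting it
   along the fibration replacing [iota] or [f] and maps into the strict
   pullback. For S2, pull the open cover of [Y] back along [f] and apply this
   to the inclusions of the sets [f^-1 (U i)]. *)

Require Import Defs.
From HB Require Import structures.
From mathcomp Require Import all_boot all_order all_algebra.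
From mathcomp Require Import all_classical all_reals.
From mathcomp Require Import ereal topology normedtype.
From mathcomp Require Import lra.
Import numFieldNormedType.Exports.
Set Implicit Arguments.
Unset Strict Implicit.
Unset Printing Implicit Defensive.
Import Order.TTheory GRing.Theory Num.Theory.
Local Open Scope classical_set_scope.
Local Open Scope ring_scope.

(** * Continuity on a subset, and maps of $\mathcal{T}$ *)

Lemma within_continuous_comp (X Y Z : topologicalType) (A : set X) (B : set Y)
    (f : X -> Y) (g : Y -> Z) :
  continuous f -> f @` A `<=` B -> {within B, continuous g} ->
  {within A, continuous (g \o f)}.
Proof.
move=> cf fAB /subspace_continuousP cg; apply/subspace_continuousP => x Ax.
have Bfx : B (f x) by apply: (fAB (f x)); exists x.
move=> W /(cg _ Bfx) gW.
apply: (@filterS _ (nbhs x) _ _ _ _ (cf x _ gW)) => y /= gWy Ay.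
by apply: gWy; apply: (fAB (f y)); exists y.
Qed.

Lemma continuous_pair (X Y Z : topologicalType) (f : X -> Y) (g : X -> Z) :
  continuous f -> continuous g -> continuous (fun x => (f x, g x)).
Proof. by move=> cf cg x; apply: cvg_pair; [exact: cf | exact: cg]. Qed.

Lemma is_map_id (X : tspace) : is_map (idfun : X -> X).
Proof. by split=> [x|_ [x bx <-]] //; exact: cvg_id. Qed.

Lemma is_map_comp (X Y Z : tspace) (f : X -> Y) (g : Y -> Z) :
  is_map f -> is_map g -> is_map (g \o f).
Proof.
move=> [cf bf] [cg bg]; split=> [x|_ [x bx <-]].
  exact: continuous_comp (cf x) (cg _).
by apply: bg; exists (f x) => //; apply: bf; exists x.
Qed.

Lemma is_map_val (Y : tspace) (U : set Y) :
  is_map (set_val : subspace_of U -> Y).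
Proof. by split=> [|_ [u bu <-]] //; exact: initial_continuous. Qed.

(** * Homotopy calculus *)

Section Homotopy.
Variable R : realType.

(** A homotopy is continuous only on $X\times[0,1]$, but the slice at time 0 lies there. So the
    relation itself certifies that its ends are maps, which later supplies [is_map] for the lifts
    given by [fibration_lift]. *)
Lemma homotopic_is_map0 (X Y : tspace) (f g : X -> Y) :
  homotopic R f g -> is_map f.
Proof.
move=> [H [[cH bH] H0 _]].
have H0E : H \o (fun x => (x, 0)) = f by apply/funext => x /=.
rewrite -H0E; split=> [|_ [x bx <-]]; last by apply: bH; rewrite ?bound_itvE.
have cx : continuous (fun x : X => (x, 0 : R)).
  by apply: continuous_pair => x; [exact: cvg_id | exact: cvg_cst].
have cHx : {within [set: X], continuous (H \o (fun x => (x, 0)))}.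
  apply: within_continuous_comp cx _ cH => _ [x _ <-].
  by split=> //=; rewrite bound_itvE.
by move=> x; have := cHx x; rewrite /continuous_at nbhs_subspaceT.
Qed.

Lemma homotopic_refl (X Y : tspace) (f : X -> Y) : is_map f -> homotopic R f f.
Proof.
move=> [cf bf]; exists (f \o fst); split=> //; split.
  apply: continuous_subspaceT => x.
  by apply: continuous_comp; [exact: cvg_fst | exact: cf].
by move=> x t bx _; apply: bf; exists x.
Qed.

Lemma homotopic_sym (X Y : tspace) (f g : X -> Y) :
  homotopic R f g -> homotopic R g f.
Proof.
move=> [H [[cH bH] H0 H1]].
exists (H \o (fun p => (p.1, 1 - p.2))); split=> [|x|x] /=; last 2 first.
- by rewrite subr0.
- by rewrite subrr.
have I01 (t : R) : t \in `[0, 1] -> 1 - t \in `[0, 1].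
  by rewrite !in_itv /= => /andP[t0 t1]; lra.
split=> [|x t bx t01]; last exact/bH/I01.
apply: within_continuous_comp cH => [|_ [[x t] [_ /= t01] <-]].
  apply: continuous_pair => p; first exact: cvg_fst.
  by apply: cvgB; [exact: cvg_cst | exact: cvg_snd].
by split=> //; apply: I01.
Qed.

Lemma homotopic_trans (X Y : tspace) (f g h : X -> Y) :
  homotopic R f g -> homotopic R g h -> homotopic R f h.
Proof.
move=> [H [[cH bH] H0 H1]] [K [[cK bK] K0 K1]].
pose d (p : X * R) := (p.1, p.2 * 2).
pose e (p : X * R) := (p.1, p.2 * 2 - 1).
have cd : continuous d.
  apply: continuous_pair => p; first exact: cvg_fst.
  by apply: cvgM; [exact: cvg_snd | exact: cvg_cst].
have ce : continuous e.
  apply: continuous_pair => p; first exact: cvg_fst.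
  by apply: cvgB; [apply: cvgM; [exact: cvg_snd | exact: cvg_cst]
                  | exact: cvg_cst].
(* Concatenation at double speed; at time 1/2 the branch of [H] is taken. *)
pose G p := if p.2 <= 2^-1 then H (d p) else K (e p).
exists G; split=> [|x|x]; last 2 first.
- by rewrite /G /d /= mul0r ifT // invr_ge0.
- rewrite /G /e /= ifF ?mul1r; last by apply/negbTE; rewrite -ltNge; lra.
  by rewrite (_ : 2 - 1 = 1) //; lra.
split=> [|x t bx]; last first.
  rewrite in_itv /= => /andP[t0 t1]; rewrite /G /=; case: ifPn => t2.
    by apply: bH => //; rewrite in_itv /=; lra.
  by apply: bK => //; rewrite in_itv /=; move: t2; rewrite -ltNge; lra.
(* The cylinder is split into two closed halves, so that the pasting lemma [withinU_continuous]
   applies. *)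
have -> : [set: X] `*` `[0, 1] =
    [set: X] `*` `[0, 2^-1] `|` [set: X] `*` `[(2^-1 : R), 1].
  apply/seteqP; split=> [[x t] [_]|[x t] [] [_]] /=; rewrite !in_itv /=.
  - move=> /andP[t0 t1]; have [t2|t2] := leP t 2^-1; [left|right];
      by split=> //; lra.
  - by move=> t01; split=> //; lra.
  - by move=> t01; split=> //; lra.
have cI (a b : R) : closed ([set: X] `*` `[a, b]).
  rewrite setTX; apply: preimage_closed => [p _|]; first exact: cvg_snd.
  exact: interval_closed.
apply: withinU_continuous => //.
- apply: (subspace_eq_continuous (f := H \o d)).
    move=> [x t]; rewrite inE /from_subspace /G => -[_] /=; rewrite in_itv /=.
    by move=> /andP[_ ->].
  apply: within_continuous_comp cH => // _ [[x t] [_ t01] <-].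
  by move: t01; rewrite /= in_itv /= => t01; split=> //=; rewrite in_itv /=; lra.
- apply: (subspace_eq_continuous (f := K \o e)).
    move=> [x t]; rewrite inE /from_subspace /G => -[_] /=; rewrite in_itv /=.
    (* On the second half [G] differs in form from [K \o e] only at time 1/2, where both [H (x, 1)]
       and [K (x, 0)] equal [g x]. *)
    move=> /andP[t2 _]; case: ifPn => // t2'; have -> : t = 2^-1 by lra.
    by rewrite /d /e /= mulVf // subrr H1 K0.
  apply: within_continuous_comp cK => // _ [[x t] [_ t01] <-].
  by move: t01; rewrite /= in_itv /= => t01; split=> //=; rewrite in_itv /=; lra.
Qed.

Lemma homotopic_is_map1 (X Y : tspace) (f g : X -> Y) :
  homotopic R f g -> is_map g.
Proof. by move=> /homotopic_sym/homotopic_is_map0. Qed.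

Lemma homotopic_compl (X Y Z : tspace) (k : Y -> Z) (f g : X -> Y) :
  is_map k -> homotopic R f g -> homotopic R (k \o f) (k \o g).
Proof.
move=> [ck bk] [H [[cH bH] H0 H1]].
exists (k \o H); split=> [|x|x] /=; rewrite ?H0 ?H1 //.
split=> [p|x t bx t01]; first exact: continuous_comp (cH p) (ck _).
by apply: bk; exists (H (x, t)) => //; apply: bH.
Qed.

Lemma homotopic_compr (X Y Z : tspace) (k : X -> Y) (f g : Y -> Z) :
  is_map k -> homotopic R f g -> homotopic R (f \o k) (g \o k).
Proof.
move=> [ck bk] [H [[cH bH] H0 H1]].
exists (H \o (fun p => (k p.1, p.2))); split=> [|x|x] //=.
split=> [|x t bx t01]; last by apply: bH => //; apply: bk; exists x.
apply: within_continuous_comp cH => [|_ [[x t] [_ t01] <-]] //.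
apply: continuous_pair => p; last exact: cvg_snd.
by apply: continuous_comp; [exact: cvg_fst | exact: ck].
Qed.

(** The end at time 1 of a lifted homotopy lies over [k] exactly. This turns a triangle commuting up
    to homotopy into a strict one, at the price of moving [g] within its homotopy class. *)
Lemma fibration_lift (T : category) (Z E Y : tspace) (pi : E -> Y)
    (g : Z -> E) (k : Z -> Y) :
  fibration R T pi -> based T Z -> is_map g -> homotopic R (pi \o g) k ->
  exists2 m : Z -> E, homotopic R g m & pi \o m = k.
Proof.
move=> [_ lift] bZ mg [h [hh h0 h1]].
have [H [hH H0 HE]] := lift Z g h bZ mg hh h0.
exists (fun z => H (z, 1)); first by exists H; split.
by apply/funext => z /=; rewrite HE // bound_itvE.
Qed.

(** * Comparison of covers, and the axioms S0 and S1 *)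

Lemma secat_op_le (A B X Y : tspace) (f : A -> X) (g : B -> Y) :
  (forall n, has_secat_cover R g n -> has_secat_cover R f n) ->
  (secat_op R f <= secat_op R g)%E.
Proof.
move=> gf; rewrite /secat_op.
(* Each side is the least admissible [n], or [+oo] if there is none, so including one set of
   admissible [n] in the other reverses the order. *)
case: pselect => [exf|nexf]; case: pselect => [exg|nexg] //.
- case: ex_minnP => m _ minm; case: ex_minnP => n /asboolP gn _.
  by rewrite lee_fin ler_nat minm //; apply/asboolP/gf.
- exact: leey.
- by case: nexf; have [n /asboolP gn] := exg; exists n; apply/asboolP/gf.
Qed.

Lemma secat_op_eq0 (A Y : tspace) (f : A -> Y) :
  secat_op R f = 0%E <-> has_secat_cover R f 0.
Proof.
rewrite /secat_op; case: pselect => [exf|nexf]; last first.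
  by split=> // f0; case: nexf; exists 0%N; apply/asboolP.
case: ex_minnP => n /asboolP fn minn; split=> [[/eqP]|f0].
  by rewrite pnatr_eq0 => /eqP n0; rewrite -n0.
by have := minn 0%N; rewrite leqn0 => /(_ (asboolT f0))/eqP ->.
Qed.

Lemma has_secat_cover0 (A Y : tspace) (iota : A -> Y) :
  has_secat_cover R iota 0 <->
  exists s : Y -> A, is_map s /\ homotopic R (iota \o s) idfun.
Proof.
split=> [[U [_ UT _ /(_ ord0)[l [ml hl]]]]|[s [ms hs]]].
  have U0 y : y \in U ord0.
    by rewrite inE; have : [set: Y] y by []; rewrite -UT => -[i _]; rewrite ord1.
  (* A cover indexed by ['I_1] has the whole of [Y] as its only member; [j] is the inverse of
     [set_val], and the section is the local one read through it. *)
  pose j (y : Y) : subspace_of (U ord0) := SigSub (U0 y).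
  have mj : is_map j.
    by split=> [|_ [y by_ <-]] //; apply: continuous_comp_initial => y; exact: cvg_id.
  exists (l \o j); split; first exact: is_map_comp.
  exact: homotopic_compr mj hl.
exists (fun=> [set: Y]); split=> //.
- by move=> _; exact: openT.
- by apply/seteqP; split=> // y _; exists ord0.
- move=> i; exists (s \o set_val); split.
    exact: is_map_comp (is_map_val _) ms.
  exact: homotopic_compr (is_map_val _) hs.
Qed.

(** The cover is kept and the local lifts are pushed along [zeta]: $\iota\zeta l\simeq\kappa l$,
    which is homotopic to the inclusion. *)
Lemma has_secat_cover_factor (A B X : tspace) (kappa : B -> X) (iota : A -> X)
    (zeta : B -> A) (n : nat) :
  is_map zeta -> homotopic R (iota \o zeta) kappa ->
  has_secat_cover R kappa n -> has_secat_cover R iota n.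
Proof.
move=> mz hz [U [oU UT bU lU]]; exists U; split=> // i.
have [l [ml hl]] := lU i; exists (zeta \o l); split; first exact: is_map_comp.
exact: homotopic_trans (homotopic_compr ml hz) hl.
Qed.

(** * Strict and homotopy pullbacks, and the axiom S2 *)

Lemma is_map_pullback (Z E X Y : tspace) (pi : E -> Y) (f : X -> Y)
    (a : Z -> E) (b : Z -> X) :
  is_map a -> is_map b -> pi \o a = f \o b ->
  exists w : Z -> pullback pi f,
    [/\ is_map w, @pullback_fst _ _ _ pi f \o w = a
      & @pullback_snd _ _ _ pi f \o w = b].
Proof.
move=> [ca ba] [cb bb] ab.
have abP z : (a z, b z) \in [set z : E * X | pi z.1 = f z.2].
  by rewrite inE; have := congr1 (fun k => k z) ab.
exists (fun z => SigSub (abP z)); split=> //; split.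
  by apply: continuous_comp_initial; exact: continuous_pair.
by move=> _ [z bz <-]; split; [apply: ba | apply: bb]; exists z.
Qed.

Lemma is_map_pullback_fst (E X Y : tspace) (pi : E -> Y) (f : X -> Y) :
  is_map (@pullback_fst _ _ _ pi f).
Proof.
split=> [u|_ [u [bu _] <-]] //.
by apply: continuous_comp; [exact: initial_continuous | exact: cvg_fst].
Qed.

Lemma is_map_pullback_snd (E X Y : tspace) (pi : E -> Y) (f : X -> Y) :
  is_map (@pullback_snd _ _ _ pi f).
Proof.
split=> [u|_ [u [_ bu] <-]] //.
by apply: continuous_comp; [exact: initial_continuous | exact: cvg_snd].
Qed.

Lemma homotopy_pullback_lift (T : category) (P A X Y Z : tspace)
    (p : P -> A) (q : P -> X) (iota : A -> Y) (f : X -> Y)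
    (a : Z -> A) (j : Z -> X) :
  based T Z -> is_map q -> homotopy_pullback R T p q iota f ->
  is_map a -> is_map j -> homotopic R (iota \o a) (f \o j) ->
  exists l : Z -> P, is_map l /\ homotopic R (q \o l) j.
Proof.
move=> bZ mq [_ sq] ma mj aj.
case: sq => -[E [e [pi [h [[_ [me [e' [me' e'e _]]] fpi eE]
                           [mh [g [mg _ hg]]] hfst hsnd]]]]].
  have {}eE : pi \o e = iota by apply/funext.
  (* First case, [iota] replaced: since $\pi e a=\iota a\simeq f j$, the map [e \o a] deforms to
     some [m] strictly over [f \o j]. The pair [(m, j)] then defines [w], and the homotopy inverse
     [g] of [h] carries it to [P]. *)
  have [||m hm mE] := fibration_lift fpi bZ (g := e \o a) (k := f \o j).
  - exact: is_map_comp.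
  - by rewrite -eE in aj.
  have [w [mw _ wE]] := is_map_pullback (homotopic_is_map1 hm) mj mE.
  exists (g \o w); split; first exact: is_map_comp.
  have mgw := is_map_comp mw mg.
  apply: homotopic_trans (homotopic_compr mgw (homotopic_sym hsnd)) _.
  rewrite -[X in homotopic _ _ X]wE.
  exact: homotopic_compl (is_map_pullback_snd _ _) (homotopic_compr mw hg).
have {}eE : pi \o e = f by apply/funext.
(* Second case, [f] replaced: now [e \o j] is deformed to some [m] strictly over [iota \o a], and
   [w] is the pair [(a, m)]. Its second coordinate is [m] rather than [j], so the result is first
   obtained after composing with [e]. *)
have [||m hm mE] := fibration_lift fpi bZ (g := e \o j) (k := iota \o a).
- exact: is_map_comp.
- by rewrite -eE in aj; exact: homotopic_sym.
have [w [mw _ wE]] := is_map_pullback ma (homotopic_is_map1 hm) (esym mE).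
exists (g \o w); split; first exact: is_map_comp.
have mgw := is_map_comp mw mg.
have heq : homotopic R (e \o (q \o (g \o w))) (e \o j).
  apply: homotopic_trans (homotopic_compr mgw (homotopic_sym hsnd)) _.
  apply: homotopic_trans (homotopic_sym hm).
  rewrite -[X in homotopic _ _ X]wE.
  exact: homotopic_compl (is_map_pullback_snd _ _) (homotopic_compr mw hg).
(* The homotopy inverse [e'] cancels [e] on both sides of [heq]. *)
apply: homotopic_trans (homotopic_compr mj e'e).
apply: homotopic_trans (homotopic_compl me' heq).
exact: homotopic_sym (homotopic_compr (is_map_comp mgw mq) e'e).
Qed.

(** The lifting property in [fibration] ranges over all based spaces, so this is what allows it to
    be applied to the members of a cover. In the pointed case [set_val] is injective and [V]
    contains the basepoint, whose preimage is therefore a single point. *)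
Lemma based_subspace_of (T : category) (X : tspace) (V : set X) :
  based T X -> base X `<=` V -> based T (subspace_of V).
Proof.
case: T => /= [X0 _|[x0 X0] bV]; first by rewrite X0 preimage_set0.
have Vx0 : x0 \in V by rewrite inE; apply: bV; rewrite X0.
exists (SigSub Vx0 : subspace_of V); rewrite X0.
by apply/seteqP; split=> [u /= ux0|u -> //]; apply: val_inj.
Qed.

Lemma has_secat_cover_pullback (T : category) (P A X Y : tspace)
    (p : P -> A) (q : P -> X) (iota : A -> Y) (f : X -> Y) (n : nat) :
  based T X -> is_map q -> is_map f -> homotopy_pullback R T p q iota f ->
  has_secat_cover R iota n -> has_secat_cover R q n.
Proof.
move=> bX mq mf sq [U [oU UT bU lU]].
have [cf bf] := mf.
have bV i : base X `<=` f @^-1` U i.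
  by move=> x bx; apply: bU; apply: bf; exists x.
exists (fun i => f @^-1` U i); split=> // [i||i].
- exact: open_comp (oU i).
- apply/seteqP; split=> // x _.
  by have : [set: Y] (f x) by []; rewrite -UT => -[i _ Ui]; exists i.
have [l [ml hl]] := lU i.
have fU (v : subspace_of (f @^-1` U i)) : f (set_val v) \in U i.
  by rewrite inE; exact: set_valP v.
(* [fi] is [f] restricted to a map from $f^{-1}(U_i)$ to $U_i$. Since [set_val \o fi] is
   [f \o set_val], composing [l] with [fi] lifts [f] on $f^{-1}(U_i)$ through [iota] up to
   homotopy. *)
pose fi v : subspace_of (U i) := SigSub (fU v).
have mfi : is_map fi.
  have [cfv bfv] := is_map_comp (is_map_val (f @^-1` U i)) mf.
  split=> [|_ [v bv <-]]; first exact: continuous_comp_initial.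
  by apply: bfv; exists v.
apply: (homotopy_pullback_lift (a := l \o fi) _ mq sq).
- exact: based_subspace_of.
- exact: is_map_comp.
- exact: is_map_val.
- exact: homotopic_compr mfi hl.
Qed.

End Homotopy.

Theorem proposition39 (R : realType) (T : category) :
  [/\ (* S0 *)
      forall (A Y : tspace) (iota : A -> Y),
        object R T A -> object R T Y -> is_map iota ->
        secat_op R iota = 0%E <->
        exists s : Y -> A, is_map s /\ homotopic R (iota \o s) idfun,
      (* S1 *)
      forall (A B X : tspace) (kappa : B -> X) (iota : A -> X) (zeta : B -> A),
        object R T A -> object R T B -> object R T X ->
        is_map kappa -> is_map iota -> is_map zeta ->
        homotopic R (iota \o zeta) kappa ->
        (secat_op R iota <= secat_op R kappa)%E
    & (* S2 *)
      forall (P A X Y : tspace)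
        (p : P -> A) (q : P -> X) (iota : A -> Y) (f : X -> Y),
        in_cat R T P -> object R T A -> object R T X -> object R T Y ->
        is_map p -> is_map q -> is_map iota -> is_map f ->
        homotopy_pullback R T p q iota f ->
        (secat_op R q <= secat_op R iota)%E].
Proof.
split.
- by move=> A Y iota _ _ _; rewrite secat_op_eq0; exact: has_secat_cover0.
- move=> A B X kappa iota zeta _ _ _ _ _ mz hz.
  by apply: secat_op_le => n; exact: has_secat_cover_factor mz hz.
- move=> P A X Y p q iota f _ _ [[bX _] _] _ _ mq _ mf sq.
  by apply: secat_op_le => n; exact: has_secat_cover_pullback bX mq mf sq.
Qed.
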